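(* Let $\mathcal P$ be a contractad in a symmetric monoidal category $\mathcal C$. Then the non-symmetric collection $\mathsf P_*(\mathcal P)$, $\mathsf P_*(\mathcal P)(n):=\mathcal P(\mathsf P_n)$ for $n\ge1$, has a natural structure of a mirrored non-symmetric operad obtained from the contractad structure of $\mathcal P$: its unit is that of $\mathcal P$, its partial compositions $\circ_i:\mathcal P(\mathsf P_n)\otimes\mathcal P(\mathsf P_m)\to\mathcal P(\mathsf P_{n+m-1})$ are the infinitesimal compositions $\circ^{\mathsf P_{n+m-1}}_G$ with $G=\{i,i+1,\dots,i+m-1\}$, and its involution $(-)^*$ on $\mathcal P(\mathsf P_n)$ is induced by the automorphism $j\mapsto n+1-j$ of $\mathsf P_n$.
   Context: Graphs are finite, simple, undirected, with non-empty vertex set. A tube of $\Gamma$ is a non-empty $G\subset V_\Gamma$ with connected induced subgraph $\Gamma|_G$. For a tube $G$, $\Gamma/G$ is the graph with vertices $\{G\}$ and $\{v\}$, $v\notin G$, two distinct blocks being adjacent iff their union is a tube. $\mathsf P_n$ is the path graph on $\{1,\dots,n\}$ with edges $(i,i+1)$. A graphical collection in $\mathcal C$ is a contravariant functor $\mathcal P$ from the groupoid of connected graphs and isomorphisms to $\mathcal C$. A contractad is a graphical collection with a unit $u:1_{\mathcal C}\to\mathcal P(\mathsf P_1)$ and infinitesimal compositions $\circ^\Gamma_G:\mathcal P(\Gamma/G)\otimes\mathcal P(\Gamma|_G)\to\mathcal P(\Gamma)$, for all connected $\Gamma$ and tubes $G$, natural under graph isomorphisms and satisfying (in element notation, with symmetry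 isomorphisms of $\mathcal C$ understood): $\lambda\circ_{\{v\}}\mathrm{Id}=\lambda=\mathrm{Id}\circ_{V_\Gamma}\lambda$, where $\mathrm{Id}$ is given by $u$; $(\lambda\circ_{G_2}\nu_2)\circ_{G_1}\nu_1=(\lambda\circ_{G_1}\nu_1)\circ_{G_2}\nu_2$ for disjoint tubes $G_1,G_2$; $\lambda\circ_H(\mu\circ_G\nu)=(\lambda\circ_{H/G}\mu)\circ_G\nu$ for tubes $G\subset H$, where $H/G$ is the image of $H$ in $\Gamma/G$. A mirrored ns operad is a non-symmetric operad $\mathcal Q$ with an involution $(-)^*:\mathcal Q\to\mathcal Q$ (arity-preserving) such that $(\mu\circ_i\nu)^*=\mu^*\circ_{n-i+1}\nu^*$ for $\mu\in\mathcal Q(n)$, $\nu\in\mathcal Q(m)$. Here $\mathsf P_{n+m-1}/G$ and $\mathsf P_{n+m-1}|_G$ are identified with $\mathsf P_n$ and $\mathsf P_m$ by the order-preserving relabellings of vertices (blocks ordered by minimal elements). *)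

(* Defs.v *)
From mathcomp Require Import all_boot zify.
Set Implicit Arguments.
Unset Strict Implicit.
Unset Printing Implicit Defensive.

Record category := Category {
  obj :> Type;
  hom : obj -> obj -> Type;
  idm : forall A, hom A A;
  compm : forall A B D, hom B D -> hom A B -> hom A D;
  compm_idl : forall A B (f : hom A B), compm (idm B) f = f;
  compm_idr : forall A B (f : hom A B), compm f (idm A) = f;
  compmA : forall A B D E (h : hom D E) (g : hom B D) (f : hom A B),
    compm h (compm g f) = compm (compm h g) f }.

Arguments hom {c} A B.
Arguments idm {c} A.
Arguments compm {c A B D} g f.

Notation "g ∘ f" := (compm g f) (at level 40, left associativity).

Reserved Notation "A ⊗ B" (at level 39, left associativity).
Reserved Notation "f ⊠ g" (at level 39, left associativity).

Record sym_mon_category := SymMonCategory {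
  smc :> category;
  unit_obj : smc;
  tens : smc -> smc -> smc where "A ⊗ B" := (tens A B);
  tensm : forall A A' B B',
    hom A A' -> hom B B' -> hom (A ⊗ B) (A' ⊗ B') where "f ⊠ g" := (tensm f g);
  assoc : forall A B D, hom (A ⊗ B ⊗ D) (A ⊗ (B ⊗ D));
  associ : forall A B D, hom (A ⊗ (B ⊗ D)) (A ⊗ B ⊗ D);
  lunit : forall A, hom (unit_obj ⊗ A) A;
  luniti : forall A, hom A (unit_obj ⊗ A);
  runit : forall A, hom (A ⊗ unit_obj) A;
  runiti : forall A, hom A (A ⊗ unit_obj);
  braid : forall A B, hom (A ⊗ B) (B ⊗ A);
  tensm_id : forall A B, idm A ⊠ idm B = idm (A ⊗ B);
  tensm_comp : forall A A' A'' B B' B'' (f' : hom A' A'') (f : hom A A')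
      (g' : hom B' B'') (g : hom B B'),
    (f' ∘ f) ⊠ (g' ∘ g) = (f' ⊠ g') ∘ (f ⊠ g);
  assocK : forall A B D, associ A B D ∘ assoc A B D = idm _;
  associK : forall A B D, assoc A B D ∘ associ A B D = idm _;
  lunitK : forall A, luniti A ∘ lunit A = idm _;
  lunitiK : forall A, lunit A ∘ luniti A = idm _;
  runitK : forall A, runiti A ∘ runit A = idm _;
  runitiK : forall A, runit A ∘ runiti A = idm _;
  assoc_nat : forall A A' B B' D D' (f : hom A A') (g : hom B B') (h : hom D D'),
    assoc A' B' D' ∘ ((f ⊠ g) ⊠ h) = (f ⊠ (g ⊠ h)) ∘ assoc A B D;
  lunit_nat : forall A A' (f : hom A A'),
    lunit A' ∘ (idm unit_obj ⊠ f) = f ∘ lunit A;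
  runit_nat : forall A A' (f : hom A A'),
    runit A' ∘ (f ⊠ idm unit_obj) = f ∘ runit A;
  braid_nat : forall A A' B B' (f : hom A A') (g : hom B B'),
    braid A' B' ∘ (f ⊠ g) = (g ⊠ f) ∘ braid A B;
  triangle : forall A B,
    (idm A ⊠ lunit B) ∘ assoc A unit_obj B = runit A ⊠ idm B;
  pentagon : forall A B D E,
    assoc A B (D ⊗ E) ∘ assoc (A ⊗ B) D E =
    (idm A ⊠ assoc B D E) ∘ assoc A (B ⊗ D) E ∘ (assoc A B D ⊠ idm E);
  hexagon : forall A B D,
    assoc B D A ∘ braid A (B ⊗ D) ∘ assoc A B D =
    (idm B ⊠ braid A D) ∘ assoc B A D ∘ (braid A B ⊠ idm D);
  braidK : forall A B, braid B A ∘ braid A B = idm (A ⊗ B) }.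

Arguments unit_obj {s}.
Arguments tens {s} A B.
Arguments tensm {s A A' B B'} f g.
Arguments assoc {s} A B D.
Arguments associ {s} A B D.
Arguments lunit {s} A.
Arguments luniti {s} A.
Arguments runit {s} A.
Arguments runiti {s} A.
Arguments braid {s} A B.

Notation "A ⊗ B" := (tens A B).
Notation "f ⊠ g" := (tensm f g).

Definition swap23 (C : sym_mon_category) (A B D : C) :
    hom (A ⊗ B ⊗ D) (A ⊗ D ⊗ B) :=
  associ A D B ∘ (idm A ⊠ braid B D) ∘ assoc A B D.

Record contra_functor (A B : category) := ContraFunctor {
  cf_obj :> A -> B;
  cf_map : forall x y : A, hom x y -> hom (cf_obj y) (cf_obj x);
  cf_id : forall x, cf_map (idm x) = idm (cf_obj x);
  cf_comp : forall x y z (g : hom y z) (f : hom x y),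
    cf_map (g ∘ f) = cf_map f ∘ cf_map g }.

Arguments cf_map {A B} c {x y} f.

(** Non-emptiness of the vertex set is part of [connected] below; every graph
    under consideration is connected. *)
Record sgraph := SGraph {
  vert :> finType;
  adj : rel vert;
  adj_sym : symmetric adj;
  adj_irr : irreflexive adj }.

Arguments adj {s} x y.

Definition connected (A : sgraph) : bool :=
  (0 < #|A|) && [forall x : A, forall y : A, connect adj x y].

Record cgraph := CGraph { cgraph_graph :> sgraph; cgraphP : connected cgraph_graph }.

Definition is_giso (A B : sgraph) (f : {ffun A -> B}) : bool :=
  [&& injectiveb f, [forall y, exists x, f x == y] &
      [forall x, forall y, adj (f x) (f y) == adj x y]].

Record giso (A B : sgraph) := GIso { giso_fun :> {ffun A -> B}; gisoP : is_giso giso_fun }.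

Lemma giso_is (A B : sgraph) (f : A -> B) :
    injective f -> (forall y, exists x, f x = y) ->
    (forall x y, adj (f x) (f y) = adj x y) -> is_giso (finfun f).
Proof.
move=> fI fS fE; apply/and3P; split.
- by apply/injectiveP => x y; rewrite !ffunE => /fI.
- by apply/forallP => y; have [x <-] := fS y; apply/existsP; exists x; rewrite ffunE.
- by apply/forallP => x; apply/forallP => y; rewrite !ffunE fE.
Qed.

Lemma giso_inj (A B : sgraph) (f : giso A B) : injective f.
Proof. by case: f => f /= /and3P[/injectiveP]. Qed.

Lemma giso_surj (A B : sgraph) (f : giso A B) y : exists x, f x = y.
Proof. by case: f => f /= /and3P[_ /forallP/(_ y)/existsP[x /eqP <-] _]; exists x. Qed.

Lemma giso_adj (A B : sgraph) (f : giso A B) x y : adj (f x) (f y) = adj x y.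
Proof. by case: f => f /= /and3P[_ _ /forallP/(_ x)/forallP/(_ y)/eqP]. Qed.

Lemma giso_eq (A B : sgraph) (f g : giso A B) : f =1 g -> f = g.
Proof.
case: f g => f fP [g gP] /= /ffunP fg; case: g / fg in gP *.
by rewrite (bool_irrelevance fP gP).
Qed.

Definition giso_id (A : sgraph) : giso A A :=
  GIso (@giso_is A A id (fun _ _ => id) (fun y => ex_intro _ y erefl)
          (fun _ _ => erefl)).

Lemma giso_comp_is (A B D : sgraph) (g : giso B D) (f : giso A B) :
  is_giso (finfun (g \o f)).
Proof.
apply: giso_is => [|z|x y /=]; first exact: inj_comp (@giso_inj _ _ g) (@giso_inj _ _ f).
  by have [y <-] := giso_surj g z; have [x <-] := giso_surj f y; exists x.
by rewrite !giso_adj.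
Qed.

Definition giso_comp (A B D : sgraph) (g : giso B D) (f : giso A B) : giso A D :=
  GIso (giso_comp_is g f).

Lemma giso_comp_idl (A B : sgraph) (f : giso A B) : giso_comp (giso_id B) f = f.
Proof. by apply: giso_eq => x; rewrite !ffunE /= !ffunE. Qed.

Lemma giso_comp_idr (A B : sgraph) (f : giso A B) : giso_comp f (giso_id A) = f.
Proof. by apply: giso_eq => x; rewrite !ffunE /= !ffunE. Qed.

Lemma giso_compA (A B D E : sgraph) (h : giso D E) (g : giso B D) (f : giso A B) :
  giso_comp h (giso_comp g f) = giso_comp (giso_comp h g) f.
Proof. by apply: giso_eq => x; rewrite !ffunE /= !ffunE. Qed.

Definition cgraph_groupoid : category :=
  @Category cgraph (fun A B => giso A B) (fun A => giso_id A)
    (fun A B D g f => giso_comp g f)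
    (fun A B => @giso_comp_idl A B) (fun A B => @giso_comp_idr A B)
    (fun A B D E => @giso_compA A B D E).

Section Induced.
Variables (A : sgraph) (S : {set A}).
Definition induced_adj : rel {x : A | x \in S} := fun x y => adj (val x) (val y).
Lemma induced_sym : symmetric induced_adj. Proof. by move=> x y; apply: adj_sym. Qed.
Lemma induced_irr : irreflexive induced_adj. Proof. by move=> x; apply: adj_irr. Qed.
Definition induced : sgraph := SGraph induced_sym induced_irr.
End Induced.

Definition in_induced (A : sgraph) (S : {set A}) (x : A) (xS : x \in S) : induced S :=
  exist (fun y => y \in S) x xS.

Definition is_tube (A : sgraph) (S : {set A}) : bool := connected (induced S).

Record tube (A : sgraph) := Tube { tube_set :> {set A}; tubeP : is_tube tube_set }.

Definition restriction (A : sgraph) (G : tube A) : cgraph := CGraph (tubeP G).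

Section Contraction.
Variables (A : sgraph) (S : {set A}).
Definition is_block (B : {set A}) : bool :=
  (B == S) || [exists v, (v \notin S) && (B == [set v])].
Definition contr_adj : rel {B : {set A} | is_block B} :=
  fun B B' => (B != B') && is_tube (val B :|: val B').
Lemma contr_sym : symmetric contr_adj.
Proof. by move=> B B'; rewrite /contr_adj eq_sym setUC. Qed.
Lemma contr_irr : irreflexive contr_adj.
Proof. by move=> B; rewrite /contr_adj eqxx. Qed.
Definition contr : sgraph := SGraph contr_sym contr_irr.
End Contraction.

Section TubeTheory.
Variable A : sgraph.

Lemma connectedP (B : sgraph) :
  reflect ((exists x : B, true) /\ forall x y : B, connect adj x y) (connected B).
Proof.
apply: (iffP andP) => [[/card_gt0P[x _] /forallP cB]|[[x _] cB]].
  by split; [exists x | move=> y z; move/forallP: (cB y)].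
by split; [apply/card_gt0P; exists x | apply/forallP => y; apply/forallP].
Qed.

Lemma tube1 (x : A) : is_tube [set x].
Proof.
apply/connectedP; split; first by exists (in_induced (set11 x)).
move=> [y yP] [z zP]; have -> : exist _ y yP = exist _ z zP :> {x0 | x0 \in [set x]}.
  by apply: val_inj; move: (yP) (zP); rewrite /= !inE => /eqP-> /eqP->.
exact: connect0.
Qed.

Lemma induced_connectS (S T : {set A}) (x y : induced S) (x' y' : induced T) :
  S \subset T -> val x = val x' -> val y = val y' ->
  connect adj x y -> connect adj x' y'.
Proof.
move=> ST ex ey /connectP[p pP ly].
elim: p x x' ex pP ly => [|z p IH] x x' ex /= pP ly.
  rewrite (_ : y' = x') ?connect0 //; apply: val_inj.
  by rewrite -ey -ex ly.
case/andP: pP => xz pP.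
pose z' : induced T := exist _ (val z) (subsetP ST _ (valP z)).
apply: (connect_trans (y := z')); last exact: IH pP ly.
by apply: connect1; rewrite /adj /= /induced_adj -ex.
Qed.

Lemma tubeU (S T : {set A}) x y : is_tube S -> is_tube T ->
  x \in S -> y \in T -> adj x y -> is_tube (S :|: T).
Proof.
move=> /connectedP[_ cS] /connectedP[_ cT] xS yT xy.
have xU : x \in S :|: T by rewrite inE xS.
have yU : y \in S :|: T by rewrite inE yT orbT.
pose x' : induced (S :|: T) := exist _ x xU.
pose y' : induced (S :|: T) := exist _ y yU.
have xy' : connect adj x' y' by apply: connect1.
have sym : connect_sym (@adj (induced (S :|: T))) by apply: sym_connect_sym; apply: adj_sym.
have cx z : connect adj x' z.
  case: z => z zU; case/setUP: (zU) => [zS|zT].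
    exact: (@induced_connectS S _ (exist _ x xS) (exist _ z zS) _ _ (subsetUl _ _)).
  apply: connect_trans xy' _.
  exact: (@induced_connectS T _ (exist _ y yT) (exist _ z zT) _ _ (subsetUr _ _)).
apply/connectedP; split; first by exists x'.
by move=> a b; apply: connect_trans (cx b); rewrite sym.
Qed.

Lemma quo_subproof (S : {set A}) (x : A) : is_block S (if x \in S then S else [set x]).
Proof.
case: ifPn => xS; first by rewrite /is_block eqxx.
by apply/orP; right; apply/existsP; exists x; rewrite xS eqxx.
Qed.

Definition quo (S : {set A}) (x : A) : contr S :=
  exist (fun B => is_block S B) _ (quo_subproof S x).

Lemma mem_quo S x : x \in val (quo S x).
Proof. by rewrite /=; case: ifPn; rewrite ?inE. Qed.

Lemma quo_mem S (B : contr S) x : x \in val B -> B = quo S x.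
Proof.
move=> xB; apply: val_inj => /=.
case: B xB => B /= /orP[/eqP-> -> //|/existsP[v /andP[vS /eqP->]]].
by rewrite inE => /eqP ->; rewrite (negPf vS).
Qed.

Lemma block_tube (G : tube A) (B : contr G) : is_tube (val B).
Proof.
case: B => B /= /orP[/eqP-> |/existsP[v /andP[_ /eqP->]]]; last exact: tube1.
exact: tubeP.
Qed.

Lemma tube_neq0 (S : {set A}) : is_tube S -> exists x, x \in S.
Proof. by case/connectedP=> [[[x xS] _] _]; exists x. Qed.

Lemma quo_adj (G : tube A) x y : adj x y -> quo G x != quo G y -> adj (quo G x) (quo G y).
Proof.
move=> xy neq; rewrite {1}/adj /= /contr_adj neq /=.
by apply: tubeU xy; rewrite ?(mem_quo G) // (block_tube (quo G _)).
Qed.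

Lemma contr_adjP (G : tube A) (B B' : contr G) :
  reflect [/\ B != B' & exists x y, [/\ x \in val B, y \in val B' & adj x y]]
          (adj B B').
Proof.
apply: (iffP andP) => [[neq tU]|[neq [x [y [xB yB xy]]]]]; last first.
  by split=> //; apply: tubeU xB yB xy; apply: block_tube.
split=> //; have [x xB] := tube_neq0 (block_tube B).
have [y yB] := tube_neq0 (block_tube B').
have /connectedP[_ c] := tU.
have xU : x \in val B :|: val B' by rewrite inE xB.
have yU : y \in val B :|: val B' by rewrite inE yB orbT.
have /connectP[p pP ly] := c (in_induced xU) (in_induced yU).
elim: p x xB xU pP ly => [|[z zU] p IH] x xB xU /= pP ly.
  move/(congr1 val): ly => /= ly; rewrite ly in yB.
  by case/eqP: neq; rewrite (quo_mem xB) (quo_mem yB).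
case/andP: pP => xz pP; case/setUP: (zU) => [zB|zB'].
  exact: (IH _ zB zU pP ly).
by exists x, z.
Qed.

End TubeTheory.

Lemma contr_connected (A : cgraph) (G : tube A) : connected (contr G).
Proof.
have /connectedP[[x0 _] cA] := cgraphP A.
apply/connectedP; split; first by exists (quo G x0).
move=> B B'.
have [x xB] := tube_neq0 (block_tube B); have [y yB] := tube_neq0 (block_tube B').
rewrite (quo_mem xB) (quo_mem yB).
case/connectP: (cA x y) => p pP ->; elim: p x pP {xB} => [|z p IH] x /=; first by rewrite connect0.
case/andP=> xz pP; apply: connect_trans (IH _ pP).
have [->|neq] := eqVneq (quo G x) (quo G z); first exact: connect0.
exact/connect1/quo_adj.
Qed.

Definition contraction (A : cgraph) (G : tube A) : cgraph := CGraph (contr_connected G).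

Notation "A // G" := (contraction (A := A) G) (at level 40, left associativity).
Notation "A \| G" := (restriction (A := A) G) (at level 40, left associativity).

Definition contr_image (A : sgraph) (G S : {set A}) : {set contr G} :=
  [set quo G x | x in S].

(** The union of the members of a block of an iterated contraction, i.e. the
    corresponding subset of the vertex set of the original graph. *)
Definition flat (A : sgraph) (G : {set A}) (W : {set contr G}) : {set A} :=
  \bigcup_(B in W) val B.

(** [pathg n] is the path with [n.+1] vertices, labelled [0, ..., n]. *)
Section Path.
Variable n : nat.
Definition path_adj : rel 'I_n.+1 := fun i j => (i.+1 == j) || (j.+1 == i).
Lemma path_sym : symmetric path_adj. Proof. by move=> i j; rewrite /path_adj orbC. Qed.
Lemma path_irr : irreflexive path_adj. Proof. by move=> i; rewrite /path_adj; lia. Qed.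
Definition path_graph : sgraph := SGraph path_sym path_irr.
End Path.

Definition interval n (a b : nat) : {set path_graph n} :=
  [set k : 'I_n.+1 | a <= k <= b].

Lemma interval_tube n a b : a <= b -> a <= n -> is_tube (interval n a b).
Proof.
move=> ab an.
have aP : (Ordinal (an : a < n.+1)) \in interval n a b by rewrite inE /= leqnn.
pose a' := in_induced aP.
have sym : connect_sym (@adj (induced (interval n a b))).
  by apply: sym_connect_sym; apply: adj_sym.
have ca z : connect adj a' z.
  case: z => [[z zn] zP]; rewrite -[exist _ _ _]/(in_induced zP).
  elim: z zn zP => [|z IH] zn zP.
    rewrite (_ : in_induced _ = a') ?connect0 //; do 2 apply: val_inj => /=.
    by move: zP; rewrite inE /=; lia.
  have [az|az] := leqP a z.
    have zP' : Ordinal (ltnW zn) \in interval n a b by move: zP; rewrite !inE /=; lia.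
    apply: connect_trans (IH _ zP') _; apply: connect1.
    by rewrite /adj /= /induced_adj /adj /= /path_adj /= eqxx.
  rewrite (_ : in_induced _ = a') ?connect0 //; do 2 apply: val_inj => /=.
  by move: zP; rewrite inE /=; lia.
apply/connectedP; split; first by exists a'.
by move=> x y; apply: connect_trans (ca y); rewrite sym.
Qed.

Lemma path_connected n : connected (path_graph n).
Proof.
have /connectedP[_ c] := @interval_tube n 0 n (leq0n n) (leq0n n).
have inI (x : 'I_n.+1) : x \in interval n 0 n by rewrite inE /= -ltnS ltn_ord.
apply/connectedP; split; first by exists ord0.
move=> x y; have /connectP[p pP e] := c (in_induced (inI x)) (in_induced (inI y)).
apply/connectP; exists [seq val z | z <- p]; last first.
  by rewrite -[x]/(val (in_induced (inI x))) last_map -e.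
by rewrite -[x]/(val (in_induced (inI x))) path_map.
Qed.

Definition pathg n : cgraph := CGraph (path_connected n).

Notation graphical_collection C := (contra_functor cgraph_groupoid C).

(** The canonical isomorphisms between iterated contractions and restrictions
    are quantified over by their (unique) characterisation in terms of the
    underlying vertices, resp. subsets, of the original graph; likewise for the
    images of tubes. *)
Record contractad (C : sym_mon_category) := Contractad {
  ctd :> graphical_collection C;
  ctd_unit : hom unit_obj (ctd (pathg 0));
  ctd_comp : forall (A : cgraph) (G : tube A), hom (ctd (A // G) ⊗ ctd (A \| G)) (ctd A);
  ctd_nat : forall (A A' : cgraph) (f : giso A A') (G : tube A) (G' : tube A')
      (fc : giso (A // G) (A' // G')) (fr : giso (A \| G) (A' \| G')),
    G' = [set f x | x in G] :> {set A'} ->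
    (forall B : A // G, val (fc B) = [set f x | x in val B]) ->
    (forall x : A \| G, val (fr x) = f (val x)) ->
    cf_map ctd f ∘ ctd_comp G' = ctd_comp G ∘ (cf_map ctd fc ⊠ cf_map ctd fr);
  ctd_unitr : forall (A : cgraph) (v : A) (G : tube A)
      (f : giso (A // G) A) (g : giso (A \| G) (pathg 0)),
    G = [set v] :> {set A} ->
    (forall B : A // G, val B = [set f B]) ->
    ctd_comp G ∘ (cf_map ctd f ⊠ (cf_map ctd g ∘ ctd_unit)) = runit (ctd A);
  ctd_unitl : forall (A : cgraph) (G : tube A)
      (f : giso (A // G) (pathg 0)) (g : giso (A \| G) A),
    G = [set: A] :> {set A} ->
    (forall x : A \| G, g x = val x) ->
    ctd_comp G ∘ ((cf_map ctd f ∘ ctd_unit) ⊠ cf_map ctd g) = lunit (ctd A);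
  ctd_disjoint : forall (A : cgraph) (G1 G2 : tube A)
      (G1' : tube (A // G2)) (G2' : tube (A // G1))
      (a1 : giso ((A // G2) \| G1') (A \| G1)) (a2 : giso ((A // G1) \| G2') (A \| G2))
      (b : giso ((A // G2) // G1') ((A // G1) // G2')),
    [disjoint G1 & G2] ->
    G1' = contr_image G2 G1 :> {set _} -> G2' = contr_image G1 G2 :> {set _} ->
    (forall x : (A // G2) \| G1', val (val x) = [set val (a1 x)]) ->
    (forall x : (A // G1) \| G2', val (val x) = [set val (a2 x)]) ->
    (forall W : (A // G2) // G1', flat (val (b W)) = flat (val W)) ->
    ctd_comp G1 ∘ ((ctd_comp G2' ∘ (idm _ ⊠ cf_map ctd a2)) ⊠ idm _) =
    ctd_comp G2 ∘ ((ctd_comp G1' ∘ (cf_map ctd b ⊠ cf_map ctd a1)) ⊠ idm _)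
      ∘ swap23 (ctd ((A // G1) // G2')) (ctd (A \| G2)) (ctd (A \| G1));
  ctd_nested : forall (A : cgraph) (G H : tube A)
      (GH : tube (A \| H)) (HG : tube (A // G))
      (c : giso ((A \| H) \| GH) (A \| G)) (d : giso ((A // G) // HG) (A // H))
      (e : giso ((A // G) \| HG) ((A \| H) // GH)),
    G \subset H ->
    GH = [set x | val x \in G] :> {set _} -> HG = contr_image G H :> {set _} ->
    (forall x : (A \| H) \| GH, val (c x) = val (val x)) ->
    (forall W : (A // G) // HG, val (d W) = flat (val W)) ->
    (forall x : (A // G) \| HG, [set val y | y in val (e x)] = val (val x)) ->
    ctd_comp H ∘ (idm (ctd (A // H)) ⊠ (ctd_comp GH ∘ (idm _ ⊠ cf_map ctd c)))
      ∘ assoc (ctd (A // H)) (ctd ((A \| H) // GH)) (ctd (A \| G)) =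
    ctd_comp G ∘ ((ctd_comp HG ∘ (cf_map ctd d ⊠ cf_map ctd e)) ⊠ idm _) }.

(** Arities are at least 1: [ns_obj Q n] is the component of arity [n.+1].
    Inputs are numbered from 0, so [ns_comp n m i] is composition at the
    [i.+1]-st input. *)
Record mirrored_ns_operad_data (C : sym_mon_category) := MirroredNsOperadData {
  ns_obj : nat -> C;
  ns_unit : hom unit_obj (ns_obj 0);
  ns_comp : forall (n m : nat) (i : 'I_n.+1),
    hom (ns_obj n ⊗ ns_obj m) (ns_obj (n + m));
  ns_inv : forall n, hom (ns_obj n) (ns_obj n) }.

Arguments ns_obj {C} Q n : rename.
Arguments ns_unit {C} Q : rename.
Arguments ns_comp {C} Q {n} m i : rename.
Arguments ns_inv {C} Q n : rename.

Definition ns_cast (C : sym_mon_category) (Q : nat -> C) n n' (e : n = n') :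
    hom (Q n) (Q n') :=
  ecast k (hom (Q n) (Q k)) e (idm (Q n)).

Record is_ns_operad (C : sym_mon_category) (Q : mirrored_ns_operad_data C) : Prop :=
    IsNsOperad {
  ns_unitr : forall n (i : 'I_n.+1),
    ns_cast (ns_obj Q) (addn0 n) ∘ ns_comp Q 0 i ∘ (idm _ ⊠ ns_unit Q) = runit _;
  ns_unitl : forall n,
    ns_cast (ns_obj Q) (add0n n) ∘ ns_comp Q n ord0 ∘ (ns_unit Q ⊠ idm _) = lunit _;
  ns_sequential : forall n m l (i : 'I_n.+1) (j : 'I_m.+1) (k : 'I_(n + m).+1),
    k = i + j :> nat ->
    ns_cast (ns_obj Q) (addnA n m l) ∘ ns_comp Q (m + l) i ∘ (idm _ ⊠ ns_comp Q l j)
      ∘ assoc _ _ _ =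
    ns_comp Q l k ∘ (ns_comp Q m i ⊠ idm _);
  ns_parallel : forall n m l (i j : 'I_n.+1) (i' : 'I_(n + l).+1) (j' : 'I_(n + m).+1),
    i < j -> i' = i :> nat -> j' = j + m :> nat ->
    ns_cast (ns_obj Q) (addnAC n l m) ∘ ns_comp Q m i' ∘ (ns_comp Q l j ⊠ idm _)
      ∘ swap23 _ _ _ =
    ns_comp Q l j' ∘ (ns_comp Q m i ⊠ idm _) }.

Record is_mirrored_ns_operad (C : sym_mon_category) (Q : mirrored_ns_operad_data C) :
    Prop := IsMirroredNsOperad {
  mns_operad : is_ns_operad Q;
  mns_invK : forall n, ns_inv Q n ∘ ns_inv Q n = idm _;
  mns_inv_comp : forall n m (i : 'I_n.+1),
    ns_inv Q (n + m) ∘ ns_comp Q m i =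
    ns_comp Q m (rev_ord i) ∘ (ns_inv Q n ⊠ ns_inv Q m) }.

Section PathIsos.
Variables (n m : nat) (i : 'I_n.+1).

Lemma path_tube_subproof : is_tube (interval (n + m) i (i + m)).
Proof. by apply: interval_tube; have := ltn_ord i; lia. Qed.

Definition path_tube : tube (pathg (n + m)) := Tube path_tube_subproof.

Lemma mem_path_tube (x : pathg (n + m)) : (x \in tube_set path_tube) = (i <= x <= i + m).
Proof. by rewrite inE. Qed.

Lemma path_restr_subproof (x : pathg (n + m) \| path_tube) :
  nat_of_ord (val x) - i < m.+1.
Proof. by case: x => x /=; rewrite inE; lia. Qed.

Definition path_restr_fun (x : pathg (n + m) \| path_tube) : pathg m :=
  Ordinal (path_restr_subproof x).

Lemma path_restr_is : is_giso (finfun path_restr_fun).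
Proof.
apply: giso_is.
- move=> [x xP] [y yP] /(congr1 val) /= e; do 2 apply: val_inj => /=.
  by move: (xP) (yP) e; rewrite !inE; lia.
- move=> y; have yP : i + y < (n + m).+1 by have := ltn_ord i; have := ltn_ord y; lia.
  have yT : Ordinal yP \in tube_set path_tube by rewrite inE /=; have := ltn_ord y; lia.
  by exists (in_induced yT); apply: val_inj; rewrite /= addKn.
- move=> [x xP] [y yP]; rewrite /adj /= /path_adj /induced_adj /adj /= /path_adj.
  by move: (xP) (yP); rewrite !inE; lia.
Qed.

Definition path_restr_iso : giso (pathg (n + m) \| path_tube) (pathg m) :=
  GIso path_restr_is.

(** The monotone surjection [{0, ..., n + m} -> {0, ..., n}] that collapses
    [{i, ..., i + m}] to [i]; its fibres are the blocks of the contraction. *)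
Definition collapse (x : nat) : nat :=
  if x < i then x else if x <= i + m then nat_of_ord i else x - m.

Ltac collapse_lia :=
  repeat match goal with |- context [if ?b then _ else _] => case: (boolP b) => ? end; lia.

Lemma collapseE x : x < i /\ collapse x = x \/
  i <= x <= i + m /\ collapse x = i \/ i + m < x /\ collapse x = x - m.
Proof. by rewrite /collapse; collapse_lia. Qed.

Lemma collapse_subproof (x : 'I_(n + m).+1) : collapse x < n.+1.
Proof. by have := ltn_ord x; have := ltn_ord i; rewrite /collapse; collapse_lia. Qed.

Lemma path_block_subproof (B : pathg (n + m) // path_tube) : {x | x \in val B}.
Proof. by apply: sigW; apply: tube_neq0 (block_tube B). Qed.

Definition path_contr_fun (B : pathg (n + m) // path_tube) : pathg n :=
  Ordinal (collapse_subproof (sval (path_block_subproof B))).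

Lemma quo_collapse (x y : pathg (n + m)) :
  (quo path_tube x == quo path_tube y) = (collapse x == collapse y).
Proof.
apply/eqP/eqP => [e|e].
  have : x \in val (quo path_tube y) by rewrite -e mem_quo.
  rewrite /=; case: ifPn => [yT xT|_]; last by rewrite inE => /eqP ->.
  by move: xT yT; rewrite !mem_path_tube /collapse; collapse_lia.
apply: quo_mem; rewrite /=; have ltx := ltn_ord x; have lty := ltn_ord y.
case: ifPn => xT; move: e xT; rewrite mem_path_tube ?inE /collapse.
  by collapse_lia.
by rewrite -val_eqE /=; collapse_lia.
Qed.

Lemma path_contr_funE (B : pathg (n + m) // path_tube) (x : pathg (n + m)) :
  x \in val B -> path_contr_fun B = collapse x :> nat.
Proof.
move=> xB /=; case: path_block_subproof => y yB /=; apply/eqP.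
by rewrite -quo_collapse -(quo_mem yB) -(quo_mem xB).
Qed.

Lemma path_contr_fun_inj : injective path_contr_fun.
Proof.
move=> B B' e; have [x xB] := path_block_subproof B.
have [y yB] := path_block_subproof B'; rewrite (quo_mem xB) (quo_mem yB); apply/eqP.
by rewrite quo_collapse -(path_contr_funE xB) -(path_contr_funE yB) e.
Qed.

Lemma path_contr_adj_step (B B' : pathg (n + m) // path_tube) :
  (path_contr_fun B).+1 = path_contr_fun B' :> nat -> adj B B'.
Proof.
move=> e; apply/contr_adjP; split.
  by apply: contra_eqN e => /eqP ->; lia.
have [x xB] := path_block_subproof B.
have [y yB] := path_block_subproof B'.
have eB := path_contr_funE xB; have eB' := path_contr_funE yB.
have ltx := ltn_ord x; have lty := ltn_ord y; have lti := ltn_ord i.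
have [x1 x1E] : exists x1, collapse x < i /\ x1 = collapse x \/
    i <= collapse x /\ x1 = collapse x + m.
  by case: (ltnP (collapse x) i) => ?; eexists; [left | right].
have := (collapseE x, collapseE y, collapseE x1, collapseE x1.+1) => -[[[hx hy] h1] h2].
have x1P : x1 < (n + m).+1 by lia.
have y1P : x1.+1 < (n + m).+1 by lia.
exists (Ordinal x1P), (Ordinal y1P); split.
- rewrite (quo_mem xB); suff -> : quo path_tube x = quo path_tube (Ordinal x1P).
    exact: mem_quo.
  by apply/eqP; rewrite quo_collapse /=; lia.
- rewrite (quo_mem yB); suff -> : quo path_tube y = quo path_tube (Ordinal y1P).
    exact: mem_quo.
  by apply/eqP; rewrite quo_collapse /=; lia.
- by rewrite /adj /= /path_adj /= eqxx.
Qed.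

Lemma path_contr_is : is_giso (finfun path_contr_fun).
Proof.
apply: giso_is; first exact: path_contr_fun_inj.
  move=> y; have lty := ltn_ord y.
  have [x xE] : exists x : nat, y <= i /\ x = y :> nat \/ i < y /\ x = y + m.
    by case: (leqP y i) => ?; eexists; [left | right].
  have xP : x < (n + m).+1 by have := ltn_ord i; lia.
  pose x' : pathg (n + m) := Ordinal xP.
  exists (quo path_tube x'); apply: val_inj.
  rewrite [LHS](path_contr_funE (mem_quo _ x')).
  by have := collapseE x; rewrite /=; lia.
move=> B B'; apply/idP/idP => [/orP[/eqP|/eqP]|].
- exact: path_contr_adj_step.
- by move/path_contr_adj_step; rewrite adj_sym.
case/contr_adjP=> neq [x [y [xB yB xy]]].
have neq' : path_contr_fun B != path_contr_fun B'.
  by apply: contra neq => /eqP/path_contr_fun_inj ->.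
move: (collapseE x) (collapseE y) xy.
rewrite -(path_contr_funE xB) -(path_contr_funE yB).
move: (path_contr_fun B) (path_contr_fun B') neq' => a b.
by rewrite -val_eqE /adj /= /path_adj; lia.
Qed.

Definition path_contr_iso : giso (pathg (n + m) // path_tube) (pathg n) :=
  GIso path_contr_is.

Lemma path_contr_iso_mono (B B' : pathg (n + m) // path_tube) (x x' : pathg (n + m)) :
    x \in val B -> (forall y, y \in val B -> x <= y) ->
    x' \in val B' -> (forall y, y \in val B' -> x' <= y) ->
  (path_contr_iso B < path_contr_iso B') = (x < x').
Proof.
move=> xB xmin xB' xmin'; rewrite !ffunE (path_contr_funE xB) (path_contr_funE xB').
have := ltn_ord x; have := ltn_ord x'; have := ltn_ord i.
have E (z t : pathg (n + m)) (D : pathg (n + m) // path_tube) : z \in val D -> (forall y, y \in val D -> z <= y) ->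
    collapse t == collapse z -> z <= t.
  move=> zD zmin; rewrite -quo_collapse => /eqP qt; apply: zmin.
  by rewrite (quo_mem zD) -qt mem_quo.
have := E x x' B xB xmin; have := E x' x B' xB' xmin'.
by have := (collapseE x, collapseE x') => -[]; lia.
Qed.

End PathIsos.

Lemma path_rev_is n : is_giso (finfun (@rev_ord n.+1 : pathg n -> pathg n)).
Proof.
apply: giso_is; first exact: rev_ord_inj.
  by move=> y; exists (rev_ord y); rewrite rev_ordK.
move=> x y; rewrite /adj /= /path_adj /=.
by have := ltn_ord x; have := ltn_ord y; lia.
Qed.

Definition path_rev n : giso (pathg n) (pathg n) := GIso (path_rev_is n).

Definition path_operad (C : sym_mon_category) (P : contractad C) :
    mirrored_ns_operad_data C :=
  {| ns_obj := fun n => P (pathg n);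
     ns_unit := ctd_unit P;
     ns_comp := fun n m i =>
       ctd_comp P (path_tube m i)
         ∘ (cf_map P (path_contr_iso m i) ⊠ cf_map P (path_restr_iso m i));
     ns_inv := fun n => cf_map P (path_rev n) |}.

(* Main.v *)
(* A tube [G] of [A], with isomorphisms from [A // G] to [B] and from [A \| G]
   to [D], amounts to a surjection [proj : A -> B] and an embedding
   [incl : D -> A]. In these terms the contractad axioms only ask for pointwise
   equations, and they hold with arbitrary models of the iterated contractions
   and restrictions. When all the models are paths, [proj] collapses an interval
   of integers and [incl] is a translation, so every condition is arithmetic; the
   identifications [n + m + l = n + (m + l)] and the reflections of paths are
   graph isomorphisms, absorbed by naturality. *)

From mathcomp Require Import all_boot zify.
Require Import Defs.
Set Implicit Arguments.
Unset Strict Implicit.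
Unset Printing Implicit Defensive.

(** * Naturality of the derived symmetric monoidal isomorphisms *)

Lemma associ_nat (C : sym_mon_category) (A A' B B' D D' : C)
    (f : hom A A') (g : hom B B') (h : hom D D') :
  associ A' B' D' ∘ (f ⊠ (g ⊠ h)) = ((f ⊠ g) ⊠ h) ∘ associ A B D.
Proof.
rewrite -[LHS]compm_idr -(associK A B D) compmA -(compmA (associ _ _ _)) -assoc_nat.
by rewrite compmA assocK compm_idl.
Qed.

Lemma swap23_nat (C : sym_mon_category) (A A' B B' D D' : C)
    (f : hom A A') (g : hom B B') (h : hom D D') :
  swap23 A' B' D' ∘ ((f ⊠ g) ⊠ h) = ((f ⊠ h) ⊠ g) ∘ swap23 A B D.
Proof.
rewrite /swap23 !compmA -associ_nat -!compmA assoc_nat (compmA _ _ (assoc A B D)).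
rewrite -tensm_comp braid_nat compm_idl -{1}[f]compm_idr tensm_comp.
by rewrite !compmA.
Qed.

(** * Inverses and quotients of graph isomorphisms, and their action on tubes *)

Section Giso.
Variables (A B : sgraph) (f : giso A B).

Lemma giso_inv_subproof y : {x | f x = y}.
Proof.
suff /sigW[x /eqP] : exists x, f x == y by exists x.
by have [x <-] := giso_surj f y; exists x.
Qed.

Definition giso_inv_fun (y : B) : A := sval (giso_inv_subproof y).

Lemma giso_inv_funK y : f (giso_inv_fun y) = y.
Proof. by rewrite /giso_inv_fun; case: giso_inv_subproof. Qed.

Lemma giso_inv_is : is_giso (finfun giso_inv_fun).
Proof.
apply: giso_is => [|x|x y]; first exact: can_inj giso_inv_funK.
  by exists (f x); apply: (@giso_inj _ _ f); rewrite giso_inv_funK.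
by rewrite -(giso_adj f) !giso_inv_funK.
Qed.

Definition giso_inv : giso B A := GIso giso_inv_is.

Lemma giso_invK y : f (giso_inv y) = y.
Proof. by rewrite ffunE giso_inv_funK. Qed.

Lemma gisoK x : giso_inv (f x) = x.
Proof. by apply: (@giso_inj _ _ f); rewrite giso_invK. Qed.

Lemma giso_connected : connected A -> connected B.
Proof.
case/connectedP=> [[x0 _] cA]; apply/connectedP; split; first by exists (f x0).
move=> x y; case/connectP: (cA (giso_inv x) (giso_inv y)) => p pP e.
apply/connectP; exists (map f p); last by rewrite -[x]giso_invK last_map -e giso_invK.
by rewrite -[x]giso_invK path_map; rewrite (eq_path (giso_adj f)).
Qed.

Lemma induced_giso_subproof (S : {set A}) (x : induced S) : f (val x) \in f @: S.
Proof. by rewrite imset_f ?(valP x). Qed.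

Definition induced_giso_fun (S : {set A}) (x : induced S) : induced (f @: S) :=
  in_induced (induced_giso_subproof x).

Lemma induced_giso_is (S : {set A}) : is_giso (finfun (@induced_giso_fun S)).
Proof.
apply: giso_is => [x y /(congr1 val) /giso_inj/val_inj //|[y yP]|x y].
  by have /imsetP[x xS e] := yP; exists (in_induced xS); apply: val_inj.
exact: giso_adj.
Qed.

Definition induced_giso (S : {set A}) : giso (induced S) (induced (f @: S)) :=
  GIso (induced_giso_is S).

End Giso.

Lemma giso_compE (A B D : sgraph) (g : giso B D) (f : giso A B) x :
  giso_comp g f x = g (f x).
Proof. by rewrite ffunE. Qed.

Definition giso_div (A B D : sgraph) (f : giso A D) (g : giso B D) : giso A B :=
  giso_comp (giso_inv g) f.

Lemma giso_divE (A B D : sgraph) (f : giso A D) (g : giso B D) x :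
  g (giso_div f g x) = f x.
Proof. by rewrite giso_compE giso_invK. Qed.

Lemma giso_divK (A B D : sgraph) (f : giso A D) (g : giso B D) :
  giso_comp g (giso_div f g) = f.
Proof. by apply: giso_eq => x; rewrite giso_compE giso_divE. Qed.

Lemma giso_is_tube (A B : sgraph) (f : giso A B) (S : {set A}) :
  is_tube (f @: S) = is_tube S.
Proof.
apply/idP/idP; last exact: giso_connected (induced_giso f S).
exact: giso_connected (giso_inv (induced_giso f S)).
Qed.

(** The blocks partition the vertices, so only the block of [x] can contribute [x] to the union. *)
Lemma mem_flat (A : sgraph) (S : {set A}) (W : {set contr S}) x :
  (x \in flat W) = (quo S x \in W).
Proof.
apply/bigcupP/idP => [[B BW /quo_mem <-]//|xW].
by exists (quo S x); rewrite ?mem_quo.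
Qed.

(** * Transport of contractions and restrictions along a graph isomorphism *)

Section TubeImage.
Variables (A B : cgraph) (f : giso A B) (G : tube A).

Lemma tube_image_subproof : is_tube (f @: tube_set G).
Proof. by rewrite giso_is_tube tubeP. Qed.

Definition tube_image : tube B := Tube tube_image_subproof.

Lemma contr_giso_subproof (D : A // G) : is_block tube_image (f @: val D).
Proof.
case: D => D /= /orP[/eqP->|/existsP[v /andP[vS /eqP->]]]; first by rewrite /is_block eqxx.
apply/orP; right; apply/existsP; exists (f v).
by rewrite /= imset_set1 eqxx andbT (mem_imset _ _ (@giso_inj _ _ f)).
Qed.

Definition contr_giso_fun (D : A // G) : B // tube_image :=
  exist (fun D => is_block tube_image D) _ (contr_giso_subproof D).

Lemma contr_giso_is : is_giso (finfun contr_giso_fun).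
Proof.
have inj : injective contr_giso_fun.
  by move=> D E /(congr1 val) /(imset_inj (@giso_inj _ _ f))/val_inj.
apply: giso_is => // [D|D E].
- have [y yD] := tube_neq0 (block_tube D); exists (quo G (giso_inv f y)).
  rewrite (quo_mem yD); apply: quo_mem.
  by rewrite -{1}[y](giso_invK f) imset_f ?mem_quo.
(* Blocks are adjacent when their union is a tube, and taking images under [f] respects both unions
   and tubes. *)
- by rewrite /adj /= /contr_adj (inj_eq inj) -imsetU giso_is_tube.
Qed.

Definition contr_giso : giso (A // G) (B // tube_image) := GIso contr_giso_is.

Lemma contr_giso_quo x : contr_giso (quo G x) = quo tube_image (f x).
Proof. by rewrite ffunE; apply: quo_mem; rewrite imset_f ?mem_quo. Qed.

Definition restr_giso : giso (A \| G) (B \| tube_image) := induced_giso f G.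

Lemma val_restr_giso (x : A \| G) : val (restr_giso x) = f (val x).
Proof. by rewrite ffunE. Qed.

End TubeImage.

(** * Tubes with chosen models of the contraction and the restriction *)

Record decomp (A B D : cgraph) := Decomp {
  dec_tube :> tube A;
  dec_contr : giso (A // dec_tube) B;
  dec_restr : giso (A \| dec_tube) D }.

Section Decomp.
Variables (A B D : cgraph) (t : decomp A B D).

Definition proj (x : A) : B := dec_contr t (quo t x).

Definition incl (y : D) : A := val (giso_inv (dec_restr t) y).

(** Blocks are the fibres of [proj]; equations between blocks thus become equations between values
    of [proj]. *)
Lemma mem_block (W : A // t) x : (x \in val W) = (proj x == dec_contr t W).
Proof.
apply/idP/eqP => [xW|/giso_inj <-]; last exact: mem_quo.
by rewrite (quo_mem xW).
Qed.

Lemma incl_restr (x : A \| t) : incl (dec_restr t x) = val x.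
Proof. by rewrite /incl gisoK. Qed.

Lemma incl_in y : incl y \in tube_set t.
Proof. exact: valP. Qed.

Lemma incl_inj : injective incl.
Proof.
move=> y z; have [x <-] := giso_surj (dec_restr t) y.
by have [x' <-] := giso_surj (dec_restr t) z; rewrite !incl_restr => /val_inj ->.
Qed.

Lemma mem_decP x : reflect (exists y, x = incl y) (x \in tube_set t).
Proof.
apply: (iffP idP) => [xt|[y ->]]; last exact: incl_in.
by exists (dec_restr t (in_induced xt)); rewrite incl_restr.
Qed.

Lemma dec_contrV x : giso_inv (dec_contr t) (proj x) = quo t x.
Proof. exact: gisoK. Qed.

Lemma proj_surj b : exists x, proj x = b.
Proof.
have [W <-] := giso_surj (dec_contr t) b.
by have [x xW] := tube_neq0 (block_tube W); exists x; rewrite (quo_mem xW).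
Qed.

(** The tube is the only block that can have two distinct elements. *)
Lemma proj_eq x y : proj x = proj y -> x = y \/ x \in tube_set t /\ y \in tube_set t.
Proof.
move=> e; have : x \in val (quo t y) by rewrite mem_block e.
by rewrite /=; case: ifP => [yt xt|_ /set1P]; [right | left].
Qed.

End Decomp.

(** The models [B] and [D] are kept. With [f] an inverse model map, this carries a decomposition of
    a model back to the actual contraction or restriction. *)
Definition dec_image (A A' B D : cgraph) (f : giso A A') (t : decomp A B D) : decomp A' B D :=
  @Decomp A' B D (tube_image f t)
    (giso_comp (dec_contr t) (giso_inv (contr_giso f t)))
    (giso_comp (dec_restr t) (giso_inv (restr_giso f t))).

Lemma proj_image (A A' B D : cgraph) (f : giso A A') (t : decomp A B D) x :
  proj (dec_image f t) (f x) = proj t x.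
Proof. by rewrite /proj giso_compE -contr_giso_quo gisoK. Qed.

Lemma proj_imageV (A A' B D : cgraph) (f : giso A A') (t : decomp A' B D) x :
  proj (dec_image (giso_inv f) t) x = proj t (f x).
Proof. by rewrite -(proj_image (giso_inv f)) gisoK. Qed.

Lemma incl_image (A A' B D : cgraph) (f : giso A A') (t : decomp A B D) y :
  incl (dec_image f t) y = f (incl t y).
Proof.
have [x <-] := giso_surj (dec_restr t) y.
rewrite incl_restr -val_restr_giso -(@incl_restr _ _ _ (dec_image f t)).
by rewrite giso_compE gisoK.
Qed.

Definition dec_relabel (A B B' D D' : cgraph) (g : giso B B') (h : giso D D')
    (t : decomp A B D) : decomp A B' D' :=
  Decomp (giso_comp g (dec_contr t)) (giso_comp h (dec_restr t)).

Lemma proj_relabel (A B B' D D' : cgraph) (g : giso B B') (h : giso D D')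
    (t : decomp A B D) x :
  proj (dec_relabel g h t) x = g (proj t x).
Proof. exact: giso_compE. Qed.

Lemma incl_relabel (A B B' D D' : cgraph) (g : giso B B') (h : giso D D')
    (t : decomp A B D) y :
  incl (dec_relabel g h t) (h y) = incl t y.
Proof.
have [x <-] := giso_surj (dec_restr t) y.
have -> : h (dec_restr t x) = dec_restr (dec_relabel g h t) x by rewrite giso_compE.
by rewrite !incl_restr.
Qed.

(** * The contractad axioms in terms of [proj] and [incl] *)

Section DecompComp.
Variables (C : sym_mon_category) (P : contractad C).

Lemma cf_giso_comp (A B D : cgraph) (g : giso B D) (f : giso A B) :
  cf_map P (giso_comp g f) = cf_map P f ∘ cf_map P g.
Proof. exact: (cf_comp P). Qed.

Lemma cf_eq_id (A : cgraph) (f : giso A A) : f =1 id -> cf_map P f = idm _.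
Proof.
move=> fE; rewrite -(cf_id P); congr cf_map.
by apply: giso_eq => x; rewrite fE /= ffunE.
Qed.

Definition dec_comp (A B D : cgraph) (t : decomp A B D) : hom (P B ⊗ P D) (P A) :=
  ctd_comp P t ∘ (cf_map P (dec_contr t) ⊠ cf_map P (dec_restr t)).

Lemma dec_comp_relabel (A B B' D D' : cgraph) (g : giso B B') (h : giso D D')
    (t : decomp A B D) :
  dec_comp (dec_relabel g h t) = dec_comp t ∘ (cf_map P g ⊠ cf_map P h).
Proof. by rewrite /dec_comp !cf_giso_comp tensm_comp compmA. Qed.

(** The two hypotheses say that the isomorphisms obtained by comparing models are the ones induced
    by [f], as the naturality axiom demands. For [f] the identity, this shows that [dec_comp]
    depends on [proj] and [incl] only. *)
Lemma dec_comp_nat (A A' B D : cgraph) (f : giso A A')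
    (t : decomp A B D) (t' : decomp A' B D) :
    (forall x, proj t' (f x) = proj t x) -> (forall y, f (incl t y) = incl t' y) ->
  cf_map P f ∘ dec_comp t' = dec_comp t.
Proof.
move=> ep ei.
pose fc : giso (A // t) (A' // t') := giso_div (dec_contr t) (dec_contr t').
pose fr : giso (A \| t) (A' \| t') := giso_div (dec_restr t) (dec_restr t').
have fcE : dec_contr t = giso_comp (dec_contr t') fc by rewrite giso_divK.
have frE : dec_restr t = giso_comp (dec_restr t') fr by rewrite giso_divK.
rewrite /dec_comp compmA (@ctd_nat _ P _ _ f t t' fc fr).
- by rewrite -compmA -tensm_comp -!cf_giso_comp -fcE -frE.
- apply/setP => x; apply/(mem_decP t')/imsetP => [[y ->]|[x' x't ->]].
    by exists (incl t y); rewrite ?ei ?incl_in.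
  by have /mem_decP[y ->] := x't; exists y.
- move=> W; apply/setP => x; have [z <-] := giso_surj f x.
  rewrite mem_imset; last exact: giso_inj.
  by rewrite !mem_block ep giso_divE.
- by move=> x; rewrite giso_compE -/(incl t' _) -ei incl_restr.
Qed.

(** Serves to replace models by actual contractions and restrictions, and later to absorb casts of
    paths. *)
Lemma dec_comp_image (A A' B D : cgraph) (f : giso A A') (t : decomp A' B D) :
  cf_map P f ∘ dec_comp t = dec_comp (dec_image (giso_inv f) t).
Proof.
by apply: dec_comp_nat => [x|y]; rewrite ?proj_imageV // incl_image giso_invK.
Qed.

Lemma dec_comp_unitr (A B : cgraph) (t : decomp A B (pathg 0)) (g : giso A B) :
  proj t =1 g -> dec_comp t ∘ (idm _ ⊠ ctd_unit P) = cf_map P g ∘ runit (P B).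
Proof.
(* The axiom wants the isomorphism sending a block [[set x]] to [x]; dividing by [g] yields it, and
   [g] itself then moves out through [runit]. *)
move=> pE; pose f : giso (A // t) A := giso_div (dec_contr t) g.
have fE : dec_contr t = giso_comp g f by rewrite giso_divK.
rewrite /dec_comp -compmA -tensm_comp fE cf_giso_comp compm_idr.
rewrite -[cf_map P _ ∘ ctd_unit P]compm_idr tensm_comp compmA.
(* The contracted vertex is the image of the only vertex of [pathg 0]. *)
rewrite (@ctd_unitr _ P A (incl t ord0)) ?runit_nat //.
  apply/setP => x; rewrite inE; apply/(mem_decP t)/eqP => [[y ->]|->]; last by exists ord0.
  by congr incl; apply: val_inj; case: y => [[]].
move=> W; apply/setP => x; rewrite inE mem_block pE giso_compE.
by rewrite -(inj_eq (@giso_inj _ _ g)) giso_invK.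
Qed.

Lemma dec_comp_unitl (A D : cgraph) (t : decomp A (pathg 0) D) (g : giso A D) :
    (forall x, incl t (g x) = x) ->
  dec_comp t ∘ (ctd_unit P ⊠ idm _) = cf_map P g ∘ lunit (P D).
Proof.
move=> iE; pose r : giso (A \| t) A := giso_div (dec_restr t) g.
have rE : dec_restr t = giso_comp g r by rewrite giso_divK.
rewrite /dec_comp -compmA -tensm_comp rE cf_giso_comp compm_idr.
rewrite -[cf_map P _ ∘ ctd_unit P]compm_idr tensm_comp compmA.
rewrite (@ctd_unitl _ P A) ?lunit_nat //.
  by apply/setP => x; rewrite inE -[x]iE incl_in.
by move=> x; rewrite giso_compE -[LHS]iE giso_invK incl_restr.
Qed.

(** [t1'] and [t2'] model the images of each tube in the contraction by the other, and [E] is a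
    common model of both double contractions. *)
Lemma dec_comp_disjoint (A B1 B2 D1 D2 E : cgraph)
    (t1 : decomp A B1 D1) (t2 : decomp A B2 D2)
    (t1' : decomp B2 E D1) (t2' : decomp B1 E D2) :
    (forall y z, incl t1 y != incl t2 z) ->
    (forall y, incl t1' y = proj t2 (incl t1 y)) ->
    (forall y, incl t2' y = proj t1 (incl t2 y)) ->
    (forall x, proj t1' (proj t2 x) = proj t2' (proj t1 x)) ->
  dec_comp t1 ∘ (dec_comp t2' ⊠ idm _) =
  dec_comp t2 ∘ (dec_comp t1' ⊠ idm _) ∘ swap23 (P E) (P D2) (P D1).
Proof.
move=> dis eI1 eI2 eP.
have dis12 : [disjoint tube_set t1 & tube_set t2].
  rewrite disjoint_subset; apply/subsetP => x /mem_decP[y ->].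
  by apply/negP => /(mem_decP t2)[z /eqP]; rewrite (negPf (dis y z)).
pose p1 := dec_image (giso_inv (dec_contr t2)) t1'.
pose p2 := dec_image (giso_inv (dec_contr t1)) t2'.
(* The comparison maps of the axiom are quotients through the shared models [D1], [D2] and [E]. *)
pose a1 : giso ((A // t2) \| p1) (A \| t1) :=
  giso_div (dec_restr p1) (dec_restr t1).
pose a2 : giso ((A // t1) \| p2) (A \| t2) :=
  giso_div (dec_restr p2) (dec_restr t2).
pose b : giso ((A // t2) // p1) ((A // t1) // p2) :=
  giso_div (dec_contr p1) (dec_contr p2).
have incl1 y : incl p1 y = quo t2 (incl t1 y) by rewrite incl_image eI1 dec_contrV.
have incl2 y : incl p2 y = quo t1 (incl t2 y) by rewrite incl_image eI2 dec_contrV.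
have p1E : p1 = contr_image t2 t1 :> {set _}.
  apply/setP => W; apply/(mem_decP p1)/imsetP => [[y ->]|[x /mem_decP[y ->] ->]].
    by exists (incl t1 y); rewrite ?incl_in.
  by exists y.
have p2E : p2 = contr_image t1 t2 :> {set _}.
  apply/setP => W; apply/(mem_decP p2)/imsetP => [[y ->]|[x /mem_decP[y ->] ->]].
    by exists (incl t2 y); rewrite ?incl_in.
  by exists y.
have a1E x : val (val x) = [set val (a1 x)].
  rewrite giso_compE -/(incl t1 _) -(@incl_restr _ _ _ p1) incl1 /=.
  (* A vertex of the first tube lies outside the second, so its block is a singleton. *)
  by rewrite (disjointFr dis12 (incl_in _ _)).
have a2E x : val (val x) = [set val (a2 x)].
  rewrite giso_compE -/(incl t2 _) -(@incl_restr _ _ _ p2) incl2 /=.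
  by rewrite (disjointFl dis12 (incl_in _ _)).
have bE W : flat (val (b W)) = flat (val W).
  apply/setP => x; rewrite !mem_flat.
  rewrite (@mem_block _ _ _ p2) (@mem_block _ _ _ p1) giso_divE -!dec_contrV.
  by rewrite !proj_image eP.
have ax := @ctd_disjoint _ P A t1 t2 p1 p2 a1 a2 b dis12 p1E p2E a1E a2E bE.
(* Both compositions are relabelled from [E] through [dec_contr p2], so that the two sides share one
   relabelling after the axiom is applied. *)
have e1 : dec_comp p1 = ctd_comp P p1 ∘ (cf_map P b ⊠ cf_map P a1)
    ∘ (cf_map P (dec_contr p2) ⊠ cf_map P (dec_restr t1)).
  by rewrite -compmA -tensm_comp -!cf_giso_comp !giso_divK.
have e2 : dec_comp p2 = ctd_comp P p2 ∘ (idm _ ⊠ cf_map P a2)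
    ∘ (cf_map P (dec_contr p2) ⊠ cf_map P (dec_restr t2)).
  by rewrite -compmA -tensm_comp -cf_giso_comp !giso_divK compm_idl.
(* Only the outer compositions are unfolded; the inner ones absorb the model maps and become those
   of [p1] and [p2]. *)
rewrite {1 3}/dec_comp -!compmA !(compmA _ (_ ⊠ idm _)) -!tensm_comp !compm_idr.
rewrite !dec_comp_image -/p1 -/p2 e1 e2.
rewrite -[cf_map P (dec_restr t1) in LHS]compm_idl -[cf_map P (dec_restr t2) in RHS]compm_idl.
(* The common relabelling of the three factors passes through [swap23]. *)
by rewrite !tensm_comp !compmA ax -compmA swap23_nat /swap23 !compmA.
Qed.

(** [K] has two roles: it models the contraction of [H] by [G] and the restriction of the contracted
    graph to [H/G]. The third hypothesis makes the two roles agree. *)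
Lemma dec_comp_nested (A B D E F K : cgraph) (tH : decomp A B D) (tG : decomp A E F)
    (tGH : decomp D K F) (tHG : decomp E B K) :
    (forall y, incl tG y = incl tH (incl tGH y)) ->
    (forall x, proj tH x = proj tHG (proj tG x)) ->
    (forall y, proj tG (incl tH y) = incl tHG (proj tGH y)) ->
  dec_comp tH ∘ (idm _ ⊠ dec_comp tGH) ∘ assoc _ _ _ =
  dec_comp tG ∘ (dec_comp tHG ⊠ idm _).
Proof.
move=> eI eP eX.
pose p1 := dec_image (giso_inv (dec_restr tH)) tGH.
pose p2 := dec_image (giso_inv (dec_contr tG)) tHG.
pose c : giso ((A \| tH) \| p1) (A \| tG) :=
  giso_div (dec_restr p1) (dec_restr tG).
pose d : giso ((A // tG) // p2) (A // tH) :=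
  giso_div (dec_contr p2) (dec_contr tH).
pose e : giso ((A // tG) \| p2) ((A \| tH) // p1) :=
  giso_div (dec_restr p2) (dec_contr p1).
have GH : tG \subset tH.
  by apply/subsetP => x /mem_decP[y ->]; rewrite eI incl_in.
have p1E : p1 = [set x | val x \in tube_set tG] :> {set _}.
  apply/setP => x; rewrite inE; apply/(mem_decP p1)/(mem_decP tG) => -[y yE]; exists y.
    by rewrite yE incl_image eI.
  by apply: val_inj; rewrite yE incl_image eI.
have p2E : p2 = contr_image tG tH :> {set _}.
  apply/setP => W; apply/(mem_decP p2)/imsetP => [[k ->]|[x /mem_decP[y ->] ->]].
    have [y <-] := proj_surj tGH k; exists (incl tH y); rewrite ?incl_in //.
    by rewrite incl_image -eX dec_contrV.
  by exists (proj tGH y); rewrite incl_image -eX dec_contrV.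
have p1proj y : proj p1 y = proj tGH (dec_restr tH y) by rewrite proj_imageV.
have cE x : val (c x) = val (val x).
  by rewrite giso_compE -/(incl tG _) eI -(@incl_restr _ _ _ p1) incl_image.
have dE W : val (d W) = flat (val W).
  apply/setP => x; rewrite mem_flat mem_block giso_divE eP.
  by rewrite (@mem_block _ _ _ p2) -dec_contrV proj_image.
have eE x : [set val y | y in val (e x)] = val (val x).
  apply/setP => z; rewrite (@mem_block _ _ _ tG) -(@incl_restr _ _ _ p2) incl_image giso_invK.
  set k := dec_restr p2 x.
  apply/imsetP/eqP => [[y yx ->]|pz].
    move: yx; rewrite (@mem_block _ _ _ p1) giso_divE p1proj -/k => /eqP <-.
    by rewrite -eX incl_restr.
  (* Some [y] in [D] lies over [k]; then [z] and [incl tH y] have equal images under [proj tG], so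
     [z] equals that vertex or lies in [G], which is inside [H]. *)
  have zH : z \in tube_set tH.
    have [y yE] := proj_surj tGH k; move: pz; rewrite -yE -eX => /proj_eq[->|[zG _]].
      exact: incl_in.
    exact: (subsetP GH).
  exists (in_induced zH) => //; rewrite (@mem_block _ _ _ p1) giso_divE p1proj.
  by apply/eqP/(@incl_inj _ _ _ tHG); rewrite -eX incl_restr.
have ax := @ctd_nested _ P A tG tH p1 p2 c d e GH p1E p2E cE dE eE.
have e1 : dec_comp p1 = ctd_comp P p1 ∘ (idm _ ⊠ cf_map P c)
    ∘ (cf_map P (dec_contr p1) ⊠ cf_map P (dec_restr tG)).
  by rewrite -compmA -tensm_comp -cf_giso_comp !giso_divK compm_idl.
have e2 : dec_comp p2 = ctd_comp P p2 ∘ (cf_map P d ⊠ cf_map P e)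
    ∘ (cf_map P (dec_contr tH) ⊠ cf_map P (dec_contr p1)).
  by rewrite -compmA -tensm_comp -!cf_giso_comp !giso_divK.
rewrite {1 3}/dec_comp -(compmA (ctd_comp _ tH)) -(compmA (ctd_comp _ tG)).
rewrite -!tensm_comp !compm_idr !dec_comp_image -/p1 -/p2 e1 e2.
rewrite -[cf_map P (dec_contr tH) in LHS]compm_idl.
rewrite -[cf_map P (dec_restr tG) in RHS]compm_idl !tensm_comp -!compmA -assoc_nat.
by rewrite !compmA ax.
Qed.

End DecompComp.

(** * Arithmetic of the decompositions of paths *)

Section PathDecomp.
Variables (n m : nat) (i : 'I_n.+1).

Definition path_decomp : decomp (pathg (n + m)) (pathg n) (pathg m) :=
  Decomp (path_contr_iso m i) (path_restr_iso m i).

Lemma proj_path (x : pathg (n + m)) :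
  proj path_decomp x =
    (if x < i then x : nat else if x <= i + m then i : nat else x - m) :> nat.
Proof. by rewrite /proj ffunE (path_contr_funE (mem_quo _ x)). Qed.

Lemma incl_path (y : pathg m) : incl path_decomp y = i + y :> nat.
Proof.
have [x <-] := giso_surj (dec_restr path_decomp) y.
rewrite incl_restr ffunE /=; have := valP x; rewrite inE /=; lia.
Qed.

End PathDecomp.

Definition path_cast n n' (e : n = n') : giso (pathg n) (pathg n') :=
  ecast k (giso (pathg n) (pathg k)) e (giso_id _).

Lemma val_path_cast n n' (e : n = n') x : path_cast e x = x :> nat.
Proof. by case: n' / e; rewrite ffunE. Qed.

Lemma val_path_castV n n' (e : n = n') x : giso_inv (path_cast e) x = x :> nat.
Proof. by rewrite -{2}[x](giso_invK (path_cast e)) val_path_cast. Qed.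

(** By contravariance, a cast from [n] to [n'] is induced by the label-preserving isomorphism in the
    other direction, hence [esym]. *)
Lemma ns_castE (C : sym_mon_category) (P : contractad C) n n' (e : n = n') :
  ns_cast (fun k => P (pathg k)) e = cf_map P (path_cast (esym e)).
Proof. by case: n' / e; rewrite [RHS]cf_id. Qed.

(** * The operad axioms and the mirror axiom *)

Theorem proposition2p4p2 (C : sym_mon_category) (P : contractad C) :
  is_mirrored_ns_operad (path_operad P).
Proof.
split; first split.
- move=> n i /=; rewrite ns_castE -/(dec_comp P (path_decomp 0 i)) -compmA.
  (* Collapsing a single vertex keeps all labels, so the comparison map is a cast, which cancels the
     one in the axiom. *)
  rewrite (@dec_comp_unitr _ _ _ _ _ (path_cast (addn0 n))).
    rewrite compmA -cf_giso_comp cf_eq_id ?compm_idl // => x.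
    by apply: ord_inj; rewrite giso_compE !val_path_cast.
  move=> x; apply: ord_inj; rewrite proj_path val_path_cast.
  by have := ltn_ord x; have := ltn_ord i; repeat case: ifP; lia.
- move=> n /=; rewrite ns_castE -/(dec_comp P (path_decomp n ord0)) -compmA.
  rewrite (@dec_comp_unitl _ _ _ _ _ (path_cast (add0n n))).
    rewrite compmA -cf_giso_comp cf_eq_id ?compm_idl // => x.
    by apply: ord_inj; rewrite giso_compE !val_path_cast.
  by move=> x; apply: ord_inj; rewrite incl_path val_path_cast.
- move=> n m l i j k kE; rewrite ns_castE /=.
  rewrite -/(dec_comp P (path_decomp (m + l) i)) -/(dec_comp P (path_decomp l j)).
  rewrite -/(dec_comp P (path_decomp l k)) -/(dec_comp P (path_decomp m i)).
  (* Here [H] is the interval from [i] to [i + m + l] and [G] the one from [k] to [k + l]; with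
     labels from 0, translating by [j] and then by [i] is translating by [k]. *)
  rewrite dec_comp_image; apply: dec_comp_nested => x; apply: ord_inj.
  + rewrite incl_image val_path_castV !incl_path; lia.
  + rewrite proj_imageV !proj_path val_path_cast kE.
    by have := ltn_ord x; have := ltn_ord i; have := ltn_ord j; repeat case: ifP; lia.
  + rewrite incl_image proj_path val_path_castV !incl_path proj_path kE.
    by have := ltn_ord x; have := ltn_ord i; have := ltn_ord j; repeat case: ifP; lia.
- move=> n m l i j i' j' ij i'E j'E; rewrite ns_castE /=.
  rewrite -/(dec_comp P (path_decomp m i')) -/(dec_comp P (path_decomp l j)).
  rewrite -/(dec_comp P (path_decomp l j')) -/(dec_comp P (path_decomp m i)).
  (* The tubes start at [j' = j + m] and at [i' = i], with lengths set by [l] and [m]; they are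
     disjoint as [i < j]. Collapsing the left one moves the start of the right one back to [j]. *)
  rewrite dec_comp_image; apply/esym/dec_comp_disjoint => [y z|y|y|x].
  + rewrite -(inj_eq (@ord_inj _)) incl_image val_path_castV !incl_path.
    by have := ltn_ord z; lia.
  + apply: ord_inj; rewrite proj_imageV proj_path val_path_cast !incl_path.
    by have := ltn_ord y; repeat case: ifP; lia.
  + apply: ord_inj; rewrite proj_path incl_image val_path_castV !incl_path.
    by have := ltn_ord y; repeat case: ifP; lia.
  + apply: ord_inj; rewrite proj_imageV !proj_path val_path_cast i'E j'E.
    by have := ltn_ord x; have := ltn_ord i; have := ltn_ord j; repeat case: ifP; lia.
- move=> n /=; rewrite -cf_giso_comp cf_eq_id // => x.
  by rewrite giso_compE !ffunE rev_ordK.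
- move=> n m i /=.
  rewrite -/(dec_comp P (path_decomp m i)) -/(dec_comp P (path_decomp m (rev_ord i))).
  (* The reflection sends the interval from [n - i] to [n - i + m] onto the one from [i] to [i + m],
     and reflects both models. *)
  rewrite -dec_comp_relabel; apply: dec_comp_nat => x; apply: ord_inj.
    rewrite proj_relabel !ffunE /= !proj_path /=.
    by have := ltn_ord x; have := ltn_ord i; repeat case: ifP; lia.
  (* [incl_relabel] evaluates only at relabelled vertices, so [x] is written as a reflection. *)
  have [y <-] := giso_surj (path_rev m) x.
  rewrite incl_relabel [in LHS]ffunE /= !incl_path ffunE /=.
  by have := ltn_ord y; have := ltn_ord i; lia.
Qed.
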